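(* Let $F(z)=\sum_{k=0}^{n}A_kz^{n-k}\in\mathbb C[z]^{p\times p}$ be monic ($A_0=I_p$) of degree $n=2m$ or $n=2m+1$, and if $n=2m+1$ assume that the even part $F_e$ is regular. Let $\mathscr S$ be the sequence of right Markov parameters of $F$ when $n=2m$ (namely $(\mathbf s_k)_{k\ge0}$), resp. of right Markov parameters of first type when $n=2m+1$ (namely $(\mathbf s_k)_{k\ge-1}$), and assume that the truncated sequence $(\mathbf s_k)_{k=0}^{2m-1}$ (when $n=2m$), resp. $(\mathbf s_k)_{k=-1}^{2m-1}$ (when $n=2m+1$), consists of Hermitian matrices. Then $F$ is Hurwitz stable if and only if $H_{m-1}^{\langle\mathscr S\rangle}\succ0$ and $H_{1,m-1}^{\langle\mathscr S\rangle}\succ0$ and, in the case $n=2m+1$, additionally $\mathbf s_{-1}\succ0$.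
   Context: Even/odd parts: if $n=2m$, $F_e(z)=\sum_{k=0}^mA_{2k}z^{m-k}$, $F_o(z)=\sum_{k=1}^mA_{2k-1}z^{m-k}$; if $n=2m+1$, $F_e(z)=\sum_{k=0}^mA_{2k+1}z^{m-k}$, $F_o(z)=\sum_{k=0}^mA_{2k}z^{m-k}$. Right Markov parameters ($n=2m$): $F_o(z)F_e(z)^{-1}=\sum_{k\ge0}(-1)^kz^{-(k+1)}\mathbf s_k$ for large $|z|$. Right Markov parameters of first type ($n=2m+1$, $F_e$ regular, i.e. $\det F_e\not\equiv 0$): $F_o(z)F_e(z)^{-1}=\mathbf s_{-1}+\sum_{k\ge0}(-1)^kz^{-(k+1)}\mathbf s_k$ for large $|z|$. Block Hankel matrices: $H_{j,k}^{\langle\mathscr S\rangle}=[\mathbf s_{j+a+b}]_{a,b=0}^{k}$ and $H_k^{\langle\mathscr S\rangle}=H_{0,k}^{\langle\mathscr S\rangle}$ (built from $\mathbf s_0,\mathbf s_1,\dots$). $A\succ0$ means $A$ is positive definite. Hurwitz stable: all roots of $\det F(z)$ lie in $\operatorname{Re}z<0$. *)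

(* Defs.v *)
From mathcomp Require Import all_boot all_algebra.
From mathcomp Require Import reals.
From mathcomp Require Export complex.
Set Implicit Arguments. Unset Strict Implicit. Unset Printing Implicit Defensive.
Import GRing.Theory Num.Theory.
Local Open Scope ring_scope.
Local Open Scope complex_scope.

Section Defs.
Variable R : realType.
Local Notation C := R[i].

Definition ctrmx (q r : nat) (M : 'M[C]_(q, r)) : 'M[C]_(r, q) :=
  map_mx (@conjc R) M^T.

Definition hermitian_mx (q : nat) (M : 'M[C]_q) : Prop := ctrmx M = M.

Definition posdef (q : nat) (M : 'M[C]_q) : Prop :=
  hermitian_mx M /\
  forall v : 'cV[C]_q, v != 0 -> 0 < (ctrmx v *m M *m v) 0 0.

Definition matpoly (p n : nat) (A : nat -> 'M[C]_p) : 'M[{poly C}]_p :=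
  \matrix_(i, j) \sum_(k < n.+1) (A k i j)%:P * 'X^(n - k).

Definition hurwitz_stable (p n : nat) (A : nat -> 'M[C]_p) : Prop :=
  forall z : C, root (\det (matpoly n A)) z -> Re z < 0.

(* coefficients (from the top degree down) of the even part F_e *)
Definition even_coef (p n : nat) (A : nat -> 'M[C]_p) (j : nat) : 'M[C]_p :=
  if (j <= n./2)%N then (if odd n then A (2 * j).+1 else A (2 * j)) else 0.

(* coefficients (from the top degree down) of the odd part F_o:
   n = 2m   : F_o(z) = sum_{j=0}^{m-1} A_{2j+1} z^{m-1-j}
   n = 2m+1 : F_o(z) = sum_{j=0}^{m}   A_{2j}   z^{m-j}   *)
Definition odd_coef (p n : nat) (A : nat -> 'M[C]_p) (j : nat) : 'M[C]_p :=
  if odd n then (if (j <= n./2)%N then A (2 * j) else 0)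
  else (if (j < n./2)%N then A (2 * j).+1 else 0).

Definition even_part (p n : nat) (A : nat -> 'M[C]_p) : 'M[{poly C}]_p :=
  \matrix_(i, k) \sum_(j < (n./2).+1) (even_coef n A j i k)%:P * 'X^(n./2 - j).

Definition regular (p : nat) (M : 'M[{poly C}]_p) : Prop := \det M != 0.

(* Right Markov parameters (n = 2m): the Laurent expansion at infinity
     F_o(z) F_e(z)^{-1} = sum_{k>=0} (-1)^k z^{-(k+1)} s_k,
   i.e. F_o(z) = (sum_k (-1)^k z^{-(k+1)} s_k) F_e(z), written coefficientwise
   (coefficient of z^{m-1-t}).
   Right Markov parameters of the first type (n = 2m+1):
     F_o(z) F_e(z)^{-1} = s_{-1} + sum_{k>=0} (-1)^k z^{-(k+1)} s_k,
   coefficientwise (coefficient of z^{m-t}).  s_{-1} is [sm1]. *)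
Definition right_markov (p n : nat) (A : nat -> 'M[C]_p)
    (sm1 : 'M[C]_p) (s : nat -> 'M[C]_p) : Prop :=
  if odd n then
    forall t : nat, odd_coef n A t =
      sm1 *m even_coef n A t
      + \sum_(k < t) ((-1) ^+ k *: s k) *m even_coef n A (t - k.+1)
  else
    forall t : nat, odd_coef n A t =
      \sum_(k < t.+1) ((-1) ^+ k *: s k) *m even_coef n A (t - k).

(* block Hankel matrix H_{j,k} = [s_{j+a+b}]_{a,b=0}^{k}, here with
   q = k+1 block rows/columns (so q = m gives H_{j,m-1}; q = 0 is empty) *)
Definition block_hankel (p : nat) (s : nat -> 'M[C]_p) (j q : nat)
  : 'M[C]_(\sum_(a < q) p) :=
  \mxblock_(a < q, b < q) s (j + a + b).

End Defs.

(* Main.v *)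
Require Import Defs.
From mathcomp Require Import all_boot all_order all_algebra.
From mathcomp Require Import reals complex ring.
Import Order.TTheory GRing.Theory Num.Theory.
Local Open Scope ring_scope.
Local Open Scope complex_scope.
Set Implicit Arguments.
Unset Strict Implicit.
Unset Printing Implicit Defensive.

(** With [w = -z^2], [q_j = (-1)^j E_j] ([E_j] the coefficients of the even
    part), [Q(w) = sum_j q_j w^(m-j)] and [P(w)] the polynomial part of
    [(sum_k w^-(k+1) s_k) Q(w)], one has, up to sign,
    [F(z) = (1 + z S) Q(w) - z P(w)], where [S] is [s_(-1)] for odd [n] and [0]
    for even [n].  If [F(z) u = 0], let [v] stack the Horner values of [Q(w) u]
    and let [y = Q(w) u].  The recurrence of the Markov parameters becomes
    [H_1 v = w H_0 v - B^* y] with [B = [s_0 ... s_(m-1)]], and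
    [(1 + z S) y = z B v].

    Pairing the first equation with [v] gives
    [Re z (v^*H_1 v + |z|^2 v^*H_0 v + y^*S y) + |y|^2 = 0], so positive
    definiteness forces [Re z < 0].

    Conversely [(v, z v, y)] is an eigenvector of a linearization [M] of [F]
    built from a block companion matrix [C] with [H_0 C = H_1], and
    [K = diag(H_1, H_0, S)] satisfies a Lyapunov equation
    [K M + M^* K = -2 L^* L] with [L (v, z v, y) = y].  If [y = 0] then [F] has
    the roots [z] and [-z], which stability excludes; hence [(L, M)] is
    observable and [K] is positive definite. *)

(** * Conjugate transposes, eigenvectors and bases over [R[i]] *)

Section ConjugateTranspose.
Variable R : realType.
Local Notation C := R[i].

Lemma ctrmxK (q r : nat) (M : 'M[C]_(q, r)) : ctrmx (ctrmx M) = M.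
Proof. by apply/matrixP=> i j; rewrite !mxE conjcK. Qed.

Lemma ctrmxM (q r t : nat) (M : 'M[C]_(q, r)) (N : 'M[C]_(r, t)) :
  ctrmx (M *m N) = ctrmx N *m ctrmx M.
Proof. by rewrite /ctrmx trmx_mul map_mxM. Qed.

Lemma ctrmxD (q r : nat) (M N : 'M[C]_(q, r)) :
  ctrmx (M + N) = ctrmx M + ctrmx N.
Proof. by apply/matrixP=> i j; rewrite !mxE rmorphD. Qed.

Lemma ctrmxN (q r : nat) (M : 'M[C]_(q, r)) : ctrmx (- M) = - ctrmx M.
Proof. by apply/matrixP=> i j; rewrite !mxE rmorphN. Qed.

Lemma ctrmxZ (q r : nat) (a : C) (M : 'M[C]_(q, r)) :
  ctrmx (a *: M) = a^* *: ctrmx M.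
Proof. by apply/matrixP=> i j; rewrite !mxE rmorphM. Qed.

Lemma ctrmx0 (q r : nat) : ctrmx (0 : 'M[C]_(q, r)) = 0.
Proof. by apply/matrixP=> i j; rewrite !mxE rmorph0. Qed.

Lemma ctrmx1 (q : nat) : ctrmx (1%:M : 'M[C]_q) = 1%:M.
Proof. by rewrite /ctrmx trmx1 map_mx1. Qed.

Lemma ctrmx_mul_ge0 (q : nat) (v : 'cV[C]_q) : 0 <= (ctrmx v *m v) 0 0.
Proof.
by rewrite !mxE sumr_ge0 // => i _; rewrite !mxE mulrC mulcJ_ge0.
Qed.

Lemma ctrmx_mul_gt0 (q : nat) (v : 'cV[C]_q) :
  v != 0 -> 0 < (ctrmx v *m v) 0 0.
Proof.
move=> v0; rewrite lt_def ctrmx_mul_ge0 andbT.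
apply: contra v0; rewrite !mxE psumr_eq0 => [/allP h|i _]; last first.
  by rewrite !mxE mulrC mulcJ_ge0.
apply/eqP/matrixP=> i j; rewrite !mxE ord1.
have := h i (mem_index_enum i); rewrite !mxE mulf_eq0 conjc_eq0 orbb.
by move/eqP.
Qed.

Lemma det0_cV (q : nat) (M : 'M[C]_q) :
  \det M = 0 -> exists2 v : 'cV[C]_q, v != 0 & M *m v = 0.
Proof.
move=> d0; have /det0P[v v0 hv] : \det M^T == 0 by rewrite det_tr d0.
exists v^T; first by rewrite -(inj_eq (can_inj (@trmxK _ _ _))) trmxK trmx0.
by rewrite -[M]trmxK -trmx_mul hv trmx0.
Qed.

Lemma eigenvector_exists (q : nat) (M : 'M[C]_q.+1) :
  exists z, exists2 v : 'cV[C]_q.+1, v != 0 & M *m v = z *: v.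
Proof.
have /closed_rootP[z] : size (char_poly M^T) != 1 by rewrite size_char_poly.
rewrite -eigenvalue_root_char => /eigenvalueP[v hv v0].
exists z, v^T; last by rewrite -[M]trmxK -trmx_mul hv linearZ.
by rewrite -(inj_eq (can_inj (@trmxK _ _ _))) trmxK trmx0.
Qed.

(** The rank factorization of [v^T] yields an invertible matrix with first column [v]; its remaining
    columns form [Y]. *)
Lemma complete_to_basis (q : nat) (v : 'cV[C]_q.+1) : v != 0 ->
  exists Y : 'M[C]_(q.+1, q),
    (forall r (X : 'M[C]_(q.+1, r)), exists a b, X = v *m a + Y *m b) /\
    (forall a (b : 'cV[C]_q), v *m a + Y *m b = 0 -> b = 0).
Proof.
move=> v0.
have [P [Pu hv]] : exists P : 'M[C]_(1 + q), P \in unitmx /\ lsubmx P = v.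
  pose w : 'rV[C]_(1 + q) := v^T.
  have rw : \rank w = 1%N.
    by rewrite rank_rV -(inj_eq (can_inj (@trmxK _ _ _))) trmxK trmx0 v0.
  have hw := mulmx_ebase w; rewrite rw in hw.
  pose c := col_ebase w 0 0.
  have cE : col_ebase w = c%:M by apply: mx11_scalar.
  have c0 : c != 0.
    by have := col_ebase_unit w; rewrite cE unitmxE det_scalar1 unitfE.
  (* As [w] has rank one, it is [c] times the first row of [row_ebase w]; scaling by [c] therefore
     makes the first column of the witness equal to [v]. *)
  exists (c *: (row_ebase w)^T); split.
    by rewrite unitmxZ ?unitfE // unitmx_tr row_ebase_unit.
  apply/matrixP=> i j; rewrite ord1.
  have -> : v i 0 = w 0 i by rewrite mxE.
  rewrite -{2}hw cE -mulmxA mul_scalar_mx !mxE big_ord_recl big1 /= => [|k _].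
    by rewrite !mxE /= mul1r addr0; congr (_ * row_ebase w _ _); apply: val_inj.
  by rewrite !mxE; case: k => [[|k] ?]; rewrite /= mul0r.
exists (rsubmx P); split=> [r X|a b h].
  pose Z := invmx P *m X.
  exists (usubmx Z), (dsubmx Z); rewrite -hv -mul_row_col hsubmxK vsubmxK.
  by rewrite mulmxA mulmxV // mul1mx.
move: h; rewrite -hv -mul_row_col hsubmxK => h.
have : col_mx a b = 0 by rewrite -[LHS](mulKmx Pu) h mulmx0.
by rewrite -col_mx0 => /eq_col_mx[].
Qed.

End ConjugateTranspose.

(** * Lyapunov equations and positive definiteness *)

Section Lyapunov.
Variable R : realType.
Local Notation C := R[i].

Lemma add_conjc_Re (z : C) : z + z^* = 2 * 'Re z.
Proof. by rewrite ReE mulrCA divff ?mulr1 ?pnatr_eq0. Qed.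

(* The form is positive at an eigenvector [v] of [M]; compressing the equation
   to the [K]-orthogonal complement of [v] preserves all hypotheses. *)
Lemma lyapunov_posdef (d r : nat) (K M : 'M[C]_d) (L : 'M[C]_(r, d)) :
  hermitian_mx K ->
  K *m M + ctrmx M *m K = -2 *: (ctrmx L *m L) ->
  (forall z (x : 'cV[C]_d), x != 0 -> M *m x = z *: x ->
     'Re z < 0 /\ L *m x != 0) ->
  posdef K.
Proof.
elim: d K M L => [|d IHd] K M L hK hM hL.
  by split=> // v; rewrite [v]flatmx0 eqxx.
have [z [v v0 hv]] := eigenvector_exists M.
have [z0 Lv0] := hL _ _ v0 hv.
pose k := (ctrmx v *m K *m v) 0 0.
have kE : ctrmx v *m K *m v = k%:M by apply: mx11_scalar.
have k_gt0 : 0 < k.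
  have hz : z + z^* < 0 by rewrite add_conjc_Re pmulr_rlt0 ?ltr0n.
  rewrite -(nmulr_rlt0 _ hz).
  have -> : (z + z^*) * k = -2 * (ctrmx (L *m v) *m (L *m v)) 0 0.
    have e : ctrmx v *m (K *m M + ctrmx M *m K) *m v = ((z + z^*) * k)%:M.
      rewrite mulmxDr mulmxDl mulmxA -[X in X + _]mulmxA hv !mulmxA -ctrmxM hv.
      by rewrite ctrmxZ -scalemxAr -!scalemxAl kE -scalerDl scale_scalar_mx.
    have -> : (z + z^*) * k = (((z + z^*) * k)%:M : 'M_1) 0 0.
      by rewrite mxE eqxx mulr1n.
    by rewrite -e hM -scalemxAr -scalemxAl mxE !ctrmxM !mulmxA.
  by rewrite nmulr_rlt0 ?ctrmx_mul_gt0 // oppr_lt0 ltr0n.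
have [Y0 [spanY freeY]] := complete_to_basis v0.
(* Gram-Schmidt with respect to the form [K]: the columns of [Y] are [K]-orthogonal to [v] and still
   complete [v] to a basis. *)
pose Y := Y0 - v *m (k^-1 *: (ctrmx v *m K *m Y0)).
have vKY : ctrmx v *m K *m Y = 0.
  rewrite mulmxBr mulmxA kE mul_scalar_mx scalerA mulfV ?gt_eqF //.
  by rewrite scale1r subrr.
have YKv : ctrmx Y *m K *m v = 0.
  by have := congr1 (@ctrmx _ _ _) vKY; rewrite !ctrmxM ctrmxK hK mulmxA ctrmx0.
have span r0 (X : 'M_(d.+1, r0)) : exists a b, X = v *m a + Y *m b.
  have [a [b ->]] := spanY _ X.
  exists (a + k^-1 *: (ctrmx v *m K *m Y0) *m b), b.
  by rewrite mulmxBl mulmxDr !mulmxA addrACA subrr addr0.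
have free (a : 'M_1) (b : 'cV_d) : v *m a + Y *m b = 0 -> b = 0.
  move=> h; apply: (freeY (a - k^-1 *: (ctrmx v *m K *m Y0) *m b)).
  by rewrite -[RHS]h mulmxBl mulmxBr !mulmxA addrAC addrA.
clearbody Y.
(* In the basis [(v, Y)] the matrix [M] is block upper triangular with diagonal blocks [z] and [M1];
   the induction hypothesis is applied to [M1]. *)
have [c [M1 MY]] := span _ (M *m Y).
pose K1 := ctrmx Y *m K *m Y.
have K1M1 : K1 *m M1 = ctrmx Y *m (K *m M) *m Y.
  rewrite !mulmxA -[RHS]mulmxA MY mulmxDr mulmxA.
  by rewrite YKv mul0mx add0r !mulmxA.
have hK1 : hermitian_mx K1.
  by rewrite /hermitian_mx /K1 !ctrmxM ctrmxK hK mulmxA.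
have [||_ pd1] := IHd K1 M1 (L *m Y) hK1.
- have -> : ctrmx M1 *m K1 = ctrmx (K1 *m M1) by rewrite ctrmxM hK1.
  have -> : ctrmx (K1 *m M1) = ctrmx Y *m (ctrmx M *m K) *m Y.
    by rewrite K1M1 !ctrmxM ctrmxK hK !mulmxA.
  by rewrite K1M1 -mulmxDl -mulmxDr hM -scalemxAr -scalemxAl ctrmxM !mulmxA.
- move=> z1 x x0 hx.
  have Yx0 a : v *m a + Y *m x != 0.
    by apply: contra x0 => /eqP/free ->.
  have MYx : M *m (Y *m x) = v *m (c *m x) + z1 *: (Y *m x).
    by rewrite mulmxA MY mulmxDl -mulmxA -[Y *m M1 *m x]mulmxA hx -scalemxAr.
  split.
    (* An eigenvalue [z1 != z] of [M1] is one of [M]: solving [c x = (z1 - z) a] makes [v a + Y x]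
       an eigenvector. *)
    have [->//|zz1] := eqVneq z1 z.
    have [a aE] : exists a, c *m x = (z1 - z) *: a.
      exists ((z1 - z)^-1 *: (c *m x)).
      by rewrite scalerA mulfV ?scale1r // subr_eq0.
    have [] // := hL z1 (v *m a + Y *m x) (Yx0 a).
    rewrite mulmxDr MYx mulmxA hv -scalemxAl addrA scalerDr; congr (_ + _).
    by rewrite aE -scalemxAr -scalerDl addrC subrK.
  (* If [L Y x = 0], pairing the equation between [v] and [Y x] leaves [k c x = 0] by
     [K]-orthogonality, so [Y x] would be an eigenvector of [M] killed by [L]. *)
  apply/negP=> /eqP LYx.
  have cx : c *m x = 0.
    have : ctrmx v *m (K *m M + ctrmx M *m K) *m (Y *m x) = k *: (c *m x).
      have e1 : ctrmx v *m (K *m M) *m (Y *m x) =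
          ctrmx v *m K *m (M *m (Y *m x)) by rewrite !mulmxA.
      rewrite mulmxDr mulmxDl e1 MYx mulmxDr !mulmxA.
      rewrite -scalemxAr !mulmxA vKY mul0mx scaler0 addr0 kE.
      rewrite mul_scalar_mx -scalemxAl -ctrmxM hv ctrmxZ -!scalemxAl.
      by rewrite vKY mul0mx scaler0 addr0.
    rewrite hM -scalemxAr -scalemxAl -!mulmxA [L *m _]mulmxA LYx.
    rewrite !mulmx0 scaler0 => /esym/eqP.
    by rewrite scaler_eq0 gt_eqF //= => /eqP.
  have := Yx0 0; rewrite mulmx0 add0r => Yx1.
  have [] := hL z1 _ Yx1; first by rewrite MYx cx mulmx0 add0r.
  by rewrite mulmxA LYx eqxx.
split=> // x x0.
have [a [b xE]] := span _ x.
have -> : (ctrmx x *m K *m x) 0 0 =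
   a 0 0 * (a 0 0)^* * k + (ctrmx b *m K1 *m b) 0 0.
  have -> : ctrmx x *m K *m x =
      ctrmx a *m (ctrmx v *m K *m v) *m a + ctrmx a *m (ctrmx v *m K *m Y) *m b
      + ctrmx b *m (ctrmx Y *m K *m v) *m a + ctrmx b *m K1 *m b.
    by rewrite xE ctrmxD !ctrmxM !mulmxDl !mulmxDr !mulmxA !addrA.
  rewrite kE vKY YKv !mulmx0 !mul0mx !addr0 mul_mx_scalar -scalemxAl.
  by rewrite mxE [in LHS]mxE mxE big_ord1 !mxE mulrC [_^* * _]mulrC.
have [b0|b0] := eqVneq b 0.
  rewrite b0 mulmx0 mxE addr0 pmulr_lgt0 // lt_def mulcJ_ge0 andbT.
  rewrite mulf_neq0 ?conjc_eq0 //;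
    apply: contra x0 => /eqP a0;
    by rewrite xE b0 mulmx0 addr0 [a]mx11_scalar a0 raddf0 mulmx0.
by rewrite ltr_wpDl ?pd1 // mulr_ge0 ?mulcJ_ge0 // ltW.
Qed.

End Lyapunov.

(** * Horner's scheme with vector coefficients *)

Section HornerSequence.
Variables (K : comNzRingType) (V : lmodType K).
Implicit Types (a b : nat -> V) (x : K).

(** The successive values of Horner's scheme at [x], coefficients listed from the top degree
    down. *)
Fixpoint hseq a x t : V :=
  if t is t'.+1 then x *: hseq a x t' + a t else a 0.

Lemma hseqE a x t : hseq a x t = \sum_(j < t.+1) x ^+ (t - j) *: a j.
Proof.
elim: t => [|t IHt] /=; first by rewrite big_ord1 scale1r.
rewrite big_ord_recr /= subnn scale1r IHt scaler_sumr; congr (_ + _).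
apply: eq_bigr => j _; rewrite scalerA -exprS subSn //.
by rewrite -ltnS ltn_ord.
Qed.

Lemma eq_hseq a b x t :
  (forall j, (j <= t)%N -> a j = b j) -> hseq a x t = hseq b x t.
Proof.
elim: t => [|t IHt] ab /=; first exact: ab.
by rewrite IHt => [|j jt]; rewrite ab // (leq_trans jt).
Qed.

Lemma hseq_shift a x t :
  a 0 = 0 -> hseq a x t.+1 = hseq (fun j => a j.+1) x t.
Proof.
move=> a0; elim: t => [|t IHt]; first by rewrite /= a0 scaler0 add0r.
by rewrite [RHS]/= -IHt.
Qed.

Lemma hseqD a b x t :
  hseq (fun j => a j + b j) x t = hseq a x t + hseq b x t.
Proof. by elim: t => //= t ->; rewrite scalerDr addrACA. Qed.

Lemma hseqN a x t : hseq (fun j => - a j) x t = - hseq a x t.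
Proof. by elim: t => //= t ->; rewrite scalerN opprD. Qed.

Lemma hseq_sign a x t :
  hseq (fun j => (-1) ^+ j *: a j) (- x) t = (-1) ^+ t *: hseq a x t.
Proof.
elim: t => [|t /= ->]; first by rewrite /= !scale1r.
rewrite scalerDr !scalerA exprS; congr (_ *: _ + _).
by rewrite mulN1r !mulNr mulrC.
Qed.

Lemma hseq_even_odd a x t :
  hseq a x (2 * t).+1
  = x *: hseq (fun j => a (2 * j)%N) (x ^+ 2) t
    + hseq (fun j => a (2 * j).+1) (x ^+ 2) t /\
  hseq a x (2 * t.+1)
  = hseq (fun j => a (2 * j)%N) (x ^+ 2) t.+1
    + x *: hseq (fun j => a (2 * j).+1) (x ^+ 2) t.
Proof.
(* One further Horner step passes from degree [2u + 1] to [2u + 2], so the induction only has to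
   establish the odd degrees. *)
have step u : hseq a x (2 * u).+1
  = x *: hseq (fun j => a (2 * j)%N) (x ^+ 2) u
    + hseq (fun j => a (2 * j).+1) (x ^+ 2) u ->
  hseq a x (2 * u.+1)
  = hseq (fun j => a (2 * j)%N) (x ^+ 2) u.+1
    + x *: hseq (fun j => a (2 * j).+1) (x ^+ 2) u.
  rewrite mulnS => h; rewrite -[LHS]/(x *: hseq a x (2 * u).+1 + _) h /=.
  by rewrite scalerDr scalerA -expr2 mulnS addrAC.
suff h : hseq a x (2 * t).+1
  = x *: hseq (fun j => a (2 * j)%N) (x ^+ 2) t
    + hseq (fun j => a (2 * j).+1) (x ^+ 2) t by split=> //; apply: step.
elim: t => [|t IHt]; first by [].
rewrite -[LHS]/(x *: hseq a x (2 * t.+1) + _) (step _ IHt).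
rewrite scalerDr scalerA -expr2 -addrA; congr (_ + _).
Qed.

Lemma hseq_signE a x t :
  hseq a x t = (-1) ^+ t *: hseq (fun j => (-1) ^+ j *: a j) (- x) t.
Proof. by rewrite hseq_sign scalerA -exprMn mulrNN mulr1 expr1n scale1r. Qed.

End HornerSequence.

(** * Horner values of Cauchy products *)

Section HornerConvolution.
Variables (K : comNzRingType) (p : nat).

(** For fixed [k], the terms with factor [s k] run through Horner's scheme for [a], delayed by [k]
    steps. *)
Lemma hseq_conv (s : nat -> 'M[K]_p) (a : nat -> 'cV[K]_p) x t :
  hseq (fun j => \sum_(k < j.+1) s k *m a (j - k)%N) x t
  = \sum_(k < t.+1) s k *m hseq a x (t - k).
Proof.
elim: t => [|t IHt] /=; first by rewrite !big_ord1.
rewrite IHt !(big_ord_recr t.+1) /= subnn /= addrA; congr (_ + _).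
rewrite scaler_sumr -big_split; apply: eq_bigr => k _ /=.
have kt : (k <= t)%N by rewrite -ltnS ltn_ord.
by rewrite subSn //= mulmxDr -scalemxAr.
Qed.

Lemma hseq_mulmx (S : 'M[K]_p) (a : nat -> 'cV[K]_p) x t :
  hseq (fun j => S *m a j) x t = S *m hseq a x t.
Proof. by elim: t => //= t ->; rewrite mulmxDr -scalemxAr. Qed.

(** Each Horner value is [x] times its predecessor plus one coefficient; those coefficients make up
    the boundary sum. *)
Lemma hseq_telescope (f : nat -> 'M[K]_p) (a : nat -> 'cV[K]_p) x m :
  f 0%N *m hseq a x m + \sum_(b < m) f b.+1 *m hseq a x (m.-1 - b)
  = x *: (\sum_(b < m) f b *m hseq a x (m.-1 - b))
    + \sum_(b < m.+1) f b *m a (m - b)%N.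
Proof.
have -> : f 0%N *m hseq a x m + \sum_(b < m) f b.+1 *m hseq a x (m.-1 - b)
    = \sum_(b < m.+1) f b *m hseq a x (m - b).
  rewrite big_ord_recl subn0; congr (_ + _); apply: eq_bigr => b _.
  by rewrite lift0 subnS -subn1 subnAC subn1.
rewrite !big_ord_recr /= subnn addrA; congr (_ + _).
rewrite scaler_sumr -big_split; apply: eq_bigr => b _ /=.
rewrite scalemxAr -mulmxDr; congr (_ *m _).
by case: m b => [[]|m] b //=; rewrite subSn // -ltnS ltn_ord.
Qed.

End HornerConvolution.

(** * The matrix polynomial in terms of its Markov parameters *)

Section MarkovParameters.
Variable R : realType.
Local Notation C := R[i].
Variables (p n : nat) (A : nat -> 'M[C]_p) (sm1 : 'M[C]_p) (s : nat -> 'M[C]_p).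

Definition signed_even_coef j : 'M[C]_p := (-1) ^+ j *: even_coef n A j.

Definition even_hseq (z : C) (u : 'cV[C]_p) : nat -> 'cV[C]_p :=
  hseq (fun j => signed_even_coef j *m u) (- z ^+ 2).

Local Notation m := n./2.
Local Notation S := (if odd n then sm1 else 0).

Lemma matpoly_horner (z : C) (u : 'cV[C]_p) :
  map_mx (horner_eval z) (matpoly n A) *m u = hseq (fun j => A j *m u) z n.
Proof.
rewrite hseqE; apply/matrixP=> i j; rewrite mxE summxE.
under eq_bigr => l _.
  rewrite !mxE /horner_eval horner_sum mulr_suml.
  under eq_bigr => k _ do rewrite hornerM hornerC hornerXn.
  over.
rewrite exchange_big /=; apply: eq_bigr => k _.
rewrite !mxE mulr_sumr; apply: eq_bigr => l _.
by rewrite mulrCA mulrA mulrC mulrA mulrC mulrA.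
Qed.

Hypothesis markov : right_markov n A sm1 s.

(** For [k <= j] the product of [(-1)^j] and [(-1)^k] is [(-1)^(j-k)], so passing to [w = -z^2]
    absorbs the alternating signs of the Markov expansion. *)
Lemma signed_conv (u : 'cV[C]_p) j :
  (-1) ^+ j *:
    ((\sum_(k < j.+1) ((-1) ^+ k *: s k) *m even_coef n A (j - k)%N) *m u)
  = \sum_(k < j.+1) s k *m (signed_even_coef (j - k)%N *m u).
Proof.
rewrite mulmx_suml scaler_sumr; apply: eq_bigr => k _.
rewrite -scalemxAl -!scalemxAl -scalemxAr scalerA mulmxA; congr (_ *: _).
have kj : (k <= j)%N by rewrite -ltnS ltn_ord.
by rewrite -{1}(subnK kj) exprD -mulrA -exprMn mulrNN mulr1 expr1n mulr1.
Qed.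

(** For both parities [F(z) = F_e(z^2) + z F_o(z^2)]; the Markov relation expresses [F_o] through
    [F_e], and [F_e(z^2) = (-1)^m Q(w)]. *)
Lemma matpoly_markov (z : C) (u : 'cV[C]_p) :
  map_mx (horner_eval z) (matpoly n A) *m u
  = (-1) ^+ m *: (even_hseq z u m + z *: (S *m even_hseq z u m)
       - z *: \sum_(k < m) s k *m even_hseq z u (m.-1 - k)).
Proof.
rewrite matpoly_horner; move: markov; rewrite /right_markov.
have [no|ne] := ifPn => mk.
  have nE : n = (2 * m).+1 by rewrite mul2n -{1}(odd_double_half n) no.
  rewrite {1}nE (hseq_even_odd _ _ _).1.
  have -> : hseq (fun j => A (2 * j).+1 *m u) (z ^+ 2) m
      = (-1) ^+ m *: even_hseq z u m.
    rewrite hseq_signE; congr (_ *: _); apply: eq_hseq => j jm.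
    by rewrite /signed_even_coef /even_coef jm no scalemxAl.
  have -> : hseq (fun j => A (2 * j)%N *m u) (z ^+ 2) m =
      (-1) ^+ m *: (S *m even_hseq z u m
       - \sum_(k < m) s k *m even_hseq z u (m.-1 - k)).
    rewrite hseq_signE; congr (_ *: _).
    (* The term [s_0] enters one degree below [s_(-1)], so the convolution is delayed by one index,
       with [c 0 = 0]. *)
    pose c j : 'cV[C]_p :=
      if j is j'.+1 then
        \sum_(k < j'.+1) s k *m (signed_even_coef (j' - k)%N *m u) else 0.
    rewrite -hseq_mulmx.
    have -> : \sum_(k < m) s k *m even_hseq z u (m.-1 - k)
        = hseq c (- z ^+ 2) m.
      case: (m) => [|m']; first by rewrite big_ord0.
      by rewrite hseq_shift //; apply/esym/hseq_conv.
    rewrite -hseqN -hseqD; apply: eq_hseq => j jm.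
    have := mk j; rewrite /odd_coef no jm => ->.
    rewrite mulmxDl scalerDr -mulmxA; congr (_ + _).
      by rewrite /signed_even_coef -scalemxAl scalemxAr.
    case: j {jm} => [|j]; first by rewrite big_ord0 mul0mx scaler0 oppr0.
    by rewrite exprS mulN1r scaleNr signed_conv.
  by rewrite scalerA [z * _]mulrC -scalerA -scalerDr scalerBr addrC addrA no.
have nE : n = (2 * m)%N by rewrite mul2n -{1}(odd_double_half n) (negPf ne).
rewrite {1}nE mul0mx scaler0 addr0.
have evE t : (t <= m)%N ->
    hseq (fun j => A (2 * j)%N *m u) (z ^+ 2) t = (-1) ^+ t *: even_hseq z u t.
  move=> tm; rewrite hseq_signE; congr (_ *: _); apply: eq_hseq => j jt.
  rewrite /signed_even_coef /even_coef (leq_trans jt tm) (negPf ne).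
  exact: scalemxAl.
(* For [m = 0] the odd part is zero; otherwise it has formal degree [m - 1 = m']. *)
case mE: (m) => [|m'] in evE *.
  by rewrite big_ord0 scaler0 subr0 -evE.
rewrite (hseq_even_odd _ _ _).2 evE // scalerBr; congr (_ + _).
have -> : hseq (fun j => A (2 * j).+1 *m u) (z ^+ 2) m'
    = (-1) ^+ m' *: \sum_(k < m'.+1) s k *m even_hseq z u (m' - k).
  rewrite hseq_signE; congr (_ *: _); rewrite -[RHS]hseq_conv.
  apply: eq_hseq => j jm; rewrite -signed_conv -(mk j) /odd_coef (negPf ne) mE.
  by rewrite ltnS jm.
rewrite !scalerA -scaleNr; congr (_ *: _).
by rewrite exprS mulN1r mulNr opprK mulrC.
Qed.

(** Since [F_o] is a polynomial, the product of the Markov series with [F_e] has no negative powers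
    of [z]. *)
Lemma markov_recurrence a :
  \sum_(b < m.+1) s (a + b)%N *m signed_even_coef (m - b)%N = 0.
Proof.
(* This is the coefficient of [z^(-a-1)]. It sits at index [a + m + 1] for odd [n] and [a + m] for
   even [n], as the expansion starts with [s_(-1)] only for odd [n]. *)
have tail : \sum_(k < (a + m).+1)
    ((-1) ^+ k *: s k) *m even_coef n A (a + m - k)%N = 0.
  move: markov; rewrite /right_markov; have [no|ne] := ifPn => mk.
    have := mk (a + m).+1; rewrite /odd_coef /even_coef no ltnNge leq_addl /=.
    by rewrite mulmx0 add0r => /esym.
  have := mk (a + m)%N; rewrite /odd_coef (negPf ne) ltnNge leq_addl /=.
  by move/esym.
(* The first [a] terms meet indices of [even_coef] above [m], where its default value is [0]. *)
rewrite -addnS big_split_ord /= big1 ?add0r in tail => [|k _]; last first.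
  rewrite /even_coef ifF ?mulmx0 //; apply/negbTE; rewrite -ltnNge.
  by rewrite ltn_subRL ltn_add2r ltn_ord.
have /= tail' := congr1 (fun X => (-1) ^+ (a + m) *: X) tail.
rewrite scaler0 in tail'.
rewrite -[RHS]tail' scaler_sumr; apply: eq_bigr => b _.
have bm : (b <= m)%N by rewrite -ltnS ltn_ord.
rewrite subnDl /signed_even_coef -scalemxAl -scalemxAr scalerA; congr (_ *: _).
have -> : (a + m = (a + b) + (m - b))%N by rewrite -addnA subnKC.
by rewrite exprD mulrAC -exprMn mulrNN mulr1 expr1n mul1r.
Qed.

End MarkovParameters.

(** * A scalar identity that forces a negative real part *)

Section ScalarBalance.
Variable F : numClosedFieldType.

(** Adding the relation to its conjugate gives [2 Re z (h1 + |z|^2 h0 + sg) = - 2 qq < 0], with a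
    nonnegative bracket. *)
Lemma Re_lt0_of_balance (z h0 h1 sg qq : F) :
  z^* * h1 + z * (z * z^*) * h0 + qq + z^* * sg = 0 ->
  0 <= h0 -> 0 <= h1 -> 0 <= sg -> 0 < qq -> 'Re z < 0.
Proof.
move=> e h00 h10 sg0 qq0.
have conj_e : z * h1 + z^* * (z * z^*) * h0 + qq + z * sg = 0.
  have := congr1 (@Num.conj F) e.
  rewrite rmorph0 !rmorphD !rmorphM /= conjCK [z^* * z]mulrC.
  rewrite (CrealP (ger0_real h00)) (CrealP (ger0_real h10)).
  by rewrite (CrealP (ger0_real sg0)) (CrealP (gtr0_real qq0)).
have T0 : 0 <= h1 + z * z^* * h0 + sg.
  by rewrite addr_ge0 // addr_ge0 // mulr_ge0 // mul_conjC_ge0.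
have sum_e : 2 * 'Re z * (h1 + z * z^* * h0 + sg) = - (2 * qq).
  apply/eqP; rewrite -addr_eq0 ReE mulrCA divff ?pnatr_eq0 // mulr1; apply/eqP.
  have -> : (z + z^*) * (h1 + z * z^* * h0 + sg) + 2 * qq
      = (z^* * h1 + z * (z * z^*) * h0 + qq + z^* * sg)
      + (z * h1 + z^* * (z * z^*) * h0 + qq + z * sg) by ring.
  by rewrite e conj_e addr0.
have neg : 2 * 'Re z * (h1 + z * z^* * h0 + sg) < 0.
  by rewrite sum_e oppr_lt0 pmulr_rgt0 ?ltr0n.
have T1 : 0 < h1 + z * z^* * h0 + sg.
  rewrite lt_def T0 andbT; apply: contraTneq neg => ->.
  by rewrite mulr0 ltxx.
by move: neg; rewrite pmulr_llt0 // pmulr_rlt0 ?ltr0n.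
Qed.

End ScalarBalance.

(** * Positive definiteness implies stability *)

Section Sufficiency.
Variable R : realType.
Local Notation C := R[i].

Lemma scale_mxcol (p q r : nat) (a : C) (g : 'I_q -> 'M[C]_(p, r)) :
  a *: \mxcol_(b < q) g b = \mxcol_(b < q) (a *: g b).
Proof. by apply/matrixP=> i j; rewrite !mxE. Qed.

Lemma ctrmx_mxrow (p q : nat) (g : 'I_q -> 'M[C]_p) :
  ctrmx (\mxrow_(b < q) g b) = \mxcol_(b < q) ctrmx (g b).
Proof. by apply/matrixP=> i j; rewrite !mxE. Qed.

(** The largest index that occurs is [j + 2(q - 1)], below [2q] as soon as [j <= 1]. *)
Lemma block_hankel_hermitian (p q j : nat) (s : nat -> 'M[C]_p) : (j <= 1)%N ->
  (forall k : nat, (k < 2 * q)%N -> hermitian_mx (s k)) ->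
  hermitian_mx (block_hankel s j q).
Proof.
move=> j1 sH.
have -> : hermitian_mx (block_hankel s j q)
    = (\mxblock_(a < q, b < q) ctrmx (s (j + b + a)%N) = block_hankel s j q).
  by congr (_ = _); apply/matrixP=> i k; rewrite !mxE.
apply: eq_mxblock => a b; rewrite addnAC; apply: sH.
rewrite mul2n -addnn; apply: (@leq_ltn_trans (1 + a + b)).
  by rewrite !leq_add2r.
by rewrite add1n -addnS leq_add.
Qed.

Lemma posdef_mulmx_eq0 (q : nat) (K : 'M[C]_q) (v : 'cV[C]_q) :
  posdef K -> K *m v = 0 -> v = 0.
Proof.
move=> [_ Kpos] Kv; apply/eqP/negP=> /negP/Kpos.
by rewrite -mulmxA Kv mulmx0 mxE ltxx.
Qed.

Lemma posdef_ge0 (q : nat) (K : 'M[C]_q) (v : 'cV[C]_q) :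
  posdef K -> 0 <= (ctrmx v *m K *m v) 0 0.
Proof.
move=> [_ Kpos]; have [->|/Kpos/ltW//] := eqVneq v 0.
by rewrite mulmx0 mxE.
Qed.

Variables (p n : nat) (A : nat -> 'M[C]_p) (sm1 : 'M[C]_p) (s : nat -> 'M[C]_p).

Local Notation m := n./2.
Local Notation S := (if odd n then sm1 else 0).

Definition even_vec (z : C) (u : 'cV[C]_p) : 'cV[C]_(\sum_(b < m) p) :=
  \mxcol_(b < m) even_hseq n A z u (m.-1 - b).

Definition markov_row : 'M[C]_(p, \sum_(b < m) p) := \mxrow_(b < m) s b.

Definition markov_conv (z : C) (u : 'cV[C]_p) (a : nat) : 'cV[C]_p :=
  \sum_(b < m) s (a + b)%N *m even_hseq n A z u (m.-1 - b).

Hypothesis A0 : A 0%N = 1%:M.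
Hypothesis markov : right_markov n A sm1 s.

(** In [hseq_telescope] with [f b = s (a + b)] the boundary sum vanishes by [markov_recurrence]. *)
Lemma markov_conv_rec z u a :
  markov_conv z u a.+1
  = - z ^+ 2 *: markov_conv z u a - s a *m even_hseq n A z u m.
Proof.
have := hseq_telescope (fun k => s (a + k)%N)
  (fun j => signed_even_coef n A j *m u) (- z ^+ 2) m.
have -> : \sum_(b < m.+1)
    s (a + b)%N *m (signed_even_coef n A (m - b) *m u) = 0.
  under eq_bigr => b _ do rewrite mulmxA.
  by rewrite -mulmx_suml (markov_recurrence markov) mul0mx.
rewrite addr0 addn0 => <-; rewrite addrAC subrr add0r; apply: eq_bigr => b _.
by rewrite addnS.
Qed.

Lemma block_hankel_even_vec z u j :
  block_hankel s j m *m even_vec z u = \mxcol_(a < m) markov_conv z u (j + a).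
Proof. by rewrite mul_mxblock_mxrow. Qed.

Lemma markov_row_even_vec z u : markov_row *m even_vec z u = markov_conv z u 0.
Proof. by rewrite mul_mxrow_mxcol. Qed.

Lemma hankel_pencil z u :
  (forall k : nat, (k < 2 * m)%N -> hermitian_mx (s k)) ->
  block_hankel s 1 m *m even_vec z u
  = - z ^+ 2 *: (block_hankel s 0 m *m even_vec z u)
    - ctrmx markov_row *m even_hseq n A z u m.
Proof.
move=> sH; rewrite !block_hankel_even_vec ctrmx_mxrow mxcol_mul.
rewrite scale_mxcol -mxcolB; apply: eq_mxcol => a.
rewrite add0n add1n markov_conv_rec.
by rewrite sH // (leq_trans (ltn_ord a)) // leq_pmull.
Qed.

(** For even [n] this coefficient is [A_0 = I]; for odd [n] it is [A_1], and the leading coefficient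
    of the Markov relation reads [I = s_(-1) A_1]. *)
Lemma even_lead_unit :
  even_coef n A 0 \in unitmx /\ (odd n -> sm1 *m even_coef n A 0 = 1%:M).
Proof.
case no : (odd n); last by rewrite /even_coef no A0 unitmx1.
have e : sm1 *m even_coef n A 0 = 1%:M.
  have := markov; rewrite /right_markov no => /(_ 0%N).
  by rewrite big_ord0 addr0 /odd_coef no leq0n A0.
by split=> //; have [] := mulmx1_unit e.
Qed.

Lemma even_hseq0_neq0 z u : u != 0 -> even_hseq n A z u 0 != 0.
Proof.
have [q0 _] := even_lead_unit; apply: contra => /eqP.
rewrite /even_hseq /= /signed_even_coef expr0 scale1r => h.
by rewrite -[u](mulKmx q0) h mulmx0.
Qed.

(** The last block is the first Horner value [q_0 u], and [q_0] is invertible. *)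
Lemma even_vec_neq0 z u : (0 < m)%N -> u != 0 -> even_vec z u != 0.
Proof.
move=> m0 /(even_hseq0_neq0 z); apply: contra => /eqP e.
have ltm : (m.-1 < m)%N by rewrite prednK.
have := congr1 (fun x => submxcol x (Ordinal ltm)) e.
by rewrite mxcolK submxcol0 /= subnn => ->.
Qed.

Definition root_vector z u :=
  even_hseq n A z u m + z *: (S *m even_hseq n A z u m)
    = z *: (markov_row *m even_vec z u).

Lemma matpoly_root_vector z u :
  map_mx (horner_eval z) (matpoly n A) *m u = 0 <-> root_vector z u.
Proof.
rewrite (matpoly_markov markov) /root_vector markov_row_even_vec /markov_conv.
set X := _ - _.
transitivity (X = 0); last first.
  split=> [/eqP|/eqP e]; first by rewrite subr_eq0 => /eqP.
  by apply/eqP; rewrite subr_eq0.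
split=> [/eqP|->]; last by rewrite scaler0.
by rewrite scaler_eq0 signr_eq0 /= => /eqP.
Qed.

Lemma root_vectorP z :
  root (\det (matpoly n A)) z <-> exists2 u, u != 0 & root_vector z u.
Proof.
have -> : root (\det (matpoly n A)) z
    = (\det (map_mx (horner_eval z) (matpoly n A)) == 0).
  by rewrite det_map_mx.
split=> [/eqP/det0_cV[u u0 /matpoly_root_vector]|[u u0 /matpoly_root_vector h]].
  by exists u.
rewrite -det_tr; apply/det0P; exists u^T.
  by rewrite -(inj_eq (can_inj (@trmxK _ _ _))) trmxK trmx0.
by rewrite -trmx_mul h trmx0.
Qed.

Hypothesis sH : forall k : nat, (k < 2 * m)%N -> hermitian_mx (s k).

(** If [y = 0], the pencil reads [H_1 v = w H_0 v]. For [z = 0] this gives [H_1 v = 0]; otherwise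
    [B v = 0], and the recurrence spreads this to every block of [H_0 v]. Either way [v = 0]. *)
Lemma posdef_even_hseq_neq0 z u :
  posdef (block_hankel s 0 m) -> posdef (block_hankel s 1 m) ->
  u != 0 -> root_vector z u -> even_hseq n A z u m != 0.
Proof.
move=> H0 H1 u0 rv; apply/negP=> /eqP q0.
have [m0|m0] := posnP m.
  move: (even_hseq0_neq0 z u0).
  by rewrite -[X in even_hseq _ _ _ _ X]m0 q0 eqxx.
have /negP := even_vec_neq0 z m0 u0; apply; apply/eqP.
have pe := hankel_pencil z u sH; rewrite q0 mulmx0 subr0 in pe.
have [z0|z0] := eqVneq z 0.
  by apply: (posdef_mulmx_eq0 H1); rewrite pe z0 expr0n oppr0 scale0r.
apply: (posdef_mulmx_eq0 H0); rewrite block_hankel_even_vec.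
have Bv : markov_conv z u 0 = 0.
  move: rv; rewrite /root_vector q0 mulmx0 scaler0 addr0 markov_row_even_vec.
  by move/esym/eqP; rewrite scaler_eq0 (negPf z0) /= => /eqP.
have all0 a : markov_conv z u a = 0.
  by elim: a => // a IHa; rewrite markov_conv_rec IHa q0 mulmx0 scaler0 subr0.
by apply/mxcolP=> a; rewrite mxcolK submxcol0 all0.
Qed.

Hypothesis smH : odd n -> hermitian_mx sm1.

Lemma posdef_hurwitz :
  posdef (block_hankel s 0 m) -> posdef (block_hankel s 1 m) ->
  (odd n -> posdef sm1) -> hurwitz_stable n A.
Proof.
move=> H0 H1 Sm z /root_vectorP[u u0 rv].
have q0 := posdef_even_hseq_neq0 H0 H1 u0 rv.
have pe := hankel_pencil z u sH.
move: rv; rewrite /root_vector.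
set q := even_hseq n A z u m in q0 pe *; set v := even_vec z u in pe *.
move=> rv.
have SH : ctrmx S = S by case: ifP => [/smH//|_]; rewrite ctrmx0.
have S0 : 0 <= (ctrmx q *m S *m q) 0 0.
  by case: ifP => [/Sm Spos|_]; [apply: posdef_ge0 | rewrite mulmx0 mul0mx mxE].
pose h0 := (ctrmx v *m block_hankel s 0 m *m v) 0 0.
pose h1 := (ctrmx v *m block_hankel s 1 m *m v) 0 0.
pose sg := (ctrmx q *m S *m q) 0 0.
pose qq := (ctrmx q *m q) 0 0.
(* The pencil is paired with [v] and multiplied by [z^*]; the adjoint of the root equation, applied
   to [q], evaluates the mixed term. *)
have e : z^* * h1 + z * (z * z^*) * h0 + qq + z^* * sg = 0.
  have e1 : z^* * (ctrmx v *m ctrmx markov_row *m q) 0 0 = qq + z^* * sg.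
    have -> : z^* * (ctrmx v *m ctrmx markov_row *m q) 0 0
        = (ctrmx (z *: (markov_row *m v)) *m q) 0 0.
      by rewrite ctrmxZ ctrmxM -scalemxAl [RHS]mxE.
    rewrite -rv ctrmxD ctrmxZ ctrmxM SH mulmxDl mxE; congr (_ + _).
    by rewrite -scalemxAl mxE.
  have e2 : h1 = - z ^+ 2 * h0 - (ctrmx v *m ctrmx markov_row *m q) 0 0.
    rewrite /h1 -mulmxA pe mulmxBr -scalemxAr !mulmxA.
    by rewrite mxE [X in X + _]mxE [X in _ + X]mxE.
  by rewrite e2 mulrBr e1; ring.
by apply: (Re_lt0_of_balance e); rewrite ?ctrmx_mul_gt0 //; apply: posdef_ge0.
Qed.

End Sufficiency.

(** * Block companion matrix and roots of the determinant *)

Section Necessity.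
Variable R : realType.
Local Notation C := R[i].
Variables (p n : nat) (A : nat -> 'M[C]_p) (sm1 : 'M[C]_p) (s : nat -> 'M[C]_p).

Local Notation m := n./2.
Local Notation D := (\sum_(b < m) p)%N.
Local Notation S := (if odd n then sm1 else 0).
Local Notation q_ := (signed_even_coef n A).
Local Notation B := (markov_row n s).

(** The block companion matrix of the monic polynomial [Q(w) q_0^-1]. *)
Definition companion : 'M[C]_D :=
  \mxblock_(a < m, b < m) ((a == b.+1 :> nat)%:R%:M
     - (b.+1 == m)%:R *: (q_ (m - a)%N *m invmx (q_ 0%N))).

Definition first_block : 'M[C]_(D, p) :=
  \mxcol_(a < m) (a == 0%N :> nat)%:R%:M.

Hypothesis A0 : A 0%N = 1%:M.
Hypothesis markov : right_markov n A sm1 s.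
Hypothesis sH : forall k : nat, (k < 2 * m)%N -> hermitian_mx (s k).

Lemma signed_even_coef0_unit : q_ 0%N \in unitmx.
Proof. by rewrite /signed_even_coef scale1r (even_lead_unit A0 markov).1. Qed.

Lemma block_hankelE q j :
  block_hankel s j q = \mxblock_(a < q, b < q) s (j + a + b)%N.
Proof. by []. Qed.

(** The subdiagonal moves the block columns of [H_0] one place to the left; [markov_recurrence],
    multiplied by [q_0^-1], supplies the last one. *)
Lemma hankel_companion :
  block_hankel s 0 m *m companion = block_hankel s 1 m.
Proof.
rewrite !block_hankelE mul_mxblock; apply: eq_mxblock => a b; rewrite add1n.
under eq_bigr => c _ do rewrite add0n mulmxBr.
rewrite sumrB; have [bm|bm] := eqVneq b.+1 m.
  rewrite big1 => [|c _]; last by rewrite bm ltn_eqF ?ltn_ord // raddf0 mulmx0.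
  have := markov_recurrence markov a; rewrite big_ord_recr /= subnn => /eqP.
  rewrite addr_eq0 => /eqP e; rewrite sub0r.
  under eq_bigr => c _ do rewrite scale1r mulmxA.
  rewrite -mulmx_suml e mulNmx opprK -mulmxA mulmxV ?signed_even_coef0_unit //.
  by rewrite mulmx1 addSnnS bm.
rewrite [X in _ - X]big1 ?subr0 => [|c _]; last by rewrite scale0r mulmx0.
have bm' : (b.+1 < m)%N by rewrite ltn_neqAle bm ltn_ord.
rewrite (bigD1 (Ordinal bm')) //= eqxx mulmx1 big1 ?addr0 ?addnS // => c.
by rewrite -val_eqE /= => /negPf ->; rewrite raddf0 mulmx0.
Qed.

Lemma hankel_first_block : block_hankel s 0 m *m first_block = ctrmx B.
Proof.
rewrite block_hankelE mul_mxblock_mxrow ctrmx_mxrow; apply: eq_mxcol => a.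
have m0 : (0 < m)%N by apply: leq_ltn_trans (ltn_ord a).
rewrite (bigD1 (Ordinal m0)) //= mulmx1 addn0 big1 ?addr0 => [|c].
  by rewrite sH // (leq_trans (ltn_ord a)) // leq_pmull.
by rewrite -val_eqE /= => /negPf ->; rewrite raddf0 mulmx0.
Qed.

(** Block row by block row, the first equation is Horner's recursion for [Q(w) u] read backwards, so
    [u] can be recovered from [x] and [y]. *)
Lemma companion_eigenvector z (x : 'cV[C]_D) (y : 'cV[C]_p) :
  companion *m x + first_block *m y = - z ^+ 2 *: x ->
  y + z *: (S *m y) = z *: (B *m x) ->
  (x != 0) || (y != 0) ->
  exists u, [/\ u != 0, root_vector n A sm1 s z u,
    even_vec n A z u = x & even_hseq n A z u m = y].
Proof.
move=> hx hy xy0.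
(* [y] followed by the blocks of [x]: these are the Horner values of [Q(w) u] in
   reverse order. *)
pose Y k : 'cV[C]_p :=
  (k == 0%N)%:R *: y + \sum_(b < m) (k == b.+1)%:R *: submxcol x b.
have Y0 : Y 0%N = y.
  by rewrite /Y scale1r big1 ?addr0 // => b _; rewrite scale0r.
have YS (b : 'I_m) : Y b.+1 = submxcol x b.
  rewrite /Y scale0r add0r (bigD1 b) //= eqxx scale1r big1 ?addr0 // => c cb.
  by rewrite eqSS (inj_eq val_inj) eq_sym (negPf cb) scale0r.
(* [Y m] must be the first Horner value [q_0 u]; for [m = 0] it is [y] itself. *)
pose u := invmx (q_ 0%N) *m Y m.
have Yrec (a : 'I_m) : Y a = - z ^+ 2 *: Y a.+1 + q_ (m - a)%N *m u.
  have m0 : m != 0%N by rewrite -lt0n; apply: leq_ltn_trans (ltn_ord a).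
  have := congr1 (fun X => submxcol X a) hx.
  rewrite -{1}(submxcolK x) mul_mxblock_mxrow mxcol_mul -mxcolD mxcolK.
  have -> : submxcol (- z ^+ 2 *: x) a = - z ^+ 2 *: Y a.+1.
    by rewrite YS; apply/matrixP=> i j; rewrite !mxE.
  move=> <-; rewrite /u {2}/Y (negPf m0) scale0r add0r !mulmx_sumr.
  rewrite addrAC -big_split /= /Y mul_scalar_mx addrC; congr (_ + _).
  apply: eq_bigr => b _.
  rewrite mulmxBl mul_scalar_mx -scalemxAl -!scalemxAr mulmxA eq_sym.
  by rewrite [m == _]eq_sym subrK.
have gY t : (t <= m)%N -> even_hseq n A z u t = Y (m - t)%N.
  elim: t => [_|t IHt tm].
    rewrite subn0 /even_hseq /= /u mulmxA mulmxV ?signed_even_coef0_unit //.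
    by rewrite mul1mx.
  rewrite /even_hseq /= -/(even_hseq n A z u t) IHt ?(ltnW tm) //.
  have am : (m - t.+1 < m)%N by rewrite ltn_subrL /= (leq_trans _ tm).
  by have := Yrec (Ordinal am); rewrite /= subKn // -subSn.
have hv : even_vec n A z u = x.
  rewrite -[RHS]submxcolK; apply: eq_mxcol => b.
  have bm : (b <= m.-1)%N.
    by rewrite -ltnS prednK // (leq_ltn_trans _ (ltn_ord b)).
  rewrite gY ?(leq_trans (leq_subr _ _)) ?leq_pred // -YS; congr Y.
  have m0 : (0 < m)%N by apply: leq_ltn_trans (ltn_ord b).
  by rewrite -{1}(prednK m0) subSn ?leq_subr // subKn.
have hq : even_hseq n A z u m = y by rewrite gY // subnn Y0.
exists u; split=> //; last by rewrite /root_vector hq hv.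
apply: contraTneq xy0 => u0; rewrite -hv -hq u0 negb_or !negbK.
have g0 t : even_hseq n A z 0 t = 0.
  rewrite /even_hseq; elim: t => [|t IHt] /=; first by rewrite mulmx0.
  by rewrite IHt scaler0 mulmx0 addr0.
rewrite g0 eqxx andbT; apply/eqP/mxcolP => a.
by rewrite mxcolK submxcol0 g0.
Qed.

(** The Horner values depend on [z] through [z^2] only, and for [y = 0] the root equation reduces to
    [B v = 0]. *)
Lemma root_vector_opp z u : even_hseq n A z u m = 0 -> z != 0 ->
  root_vector n A sm1 s z u -> root_vector n A sm1 s (- z) u.
Proof.
rewrite /root_vector /even_vec /even_hseq sqrrN => -> z0.
rewrite mulmx0 !scaler0 addr0 => /esym/eqP.
by rewrite scaler_eq0 (negPf z0) /= => /eqP ->; rewrite scaler0.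
Qed.

(** Supplies the spectral hypothesis of [lyapunov_posdef] for both parities; [y != 0] is
    observability. *)
Lemma companion_stable z (x : 'cV[C]_D) (y : 'cV[C]_p) :
  hurwitz_stable n A ->
  companion *m x + first_block *m y = - z ^+ 2 *: x ->
  y + z *: (S *m y) = z *: (B *m x) ->
  (x != 0) || (y != 0) -> 'Re z < 0 /\ y != 0.
Proof.
move=> stab hx hy /(companion_eigenvector hx hy)[u [u0 rv hv hq]].
have z0 : 'Re z < 0.
  by apply: stab; apply: (proj2 (root_vectorP markov _)); exists u.
split=> //; apply/negP=> /eqP y0.
have : 'Re (- z) < 0.
  apply: stab; apply: (proj2 (root_vectorP markov _)); exists u => //.
  apply: root_vector_opp => //; first by rewrite hq.
  by apply: contraTneq z0 => ->; rewrite raddf0 ltxx.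
by rewrite raddfN /= oppr_lt0 => /(lt_trans z0); rewrite ltxx.
Qed.

End Necessity.

(** * Stability implies positive definiteness *)

Section LyapunovEquations.
Variable R : realType.
Local Notation C := R[i].

Lemma ctrmx_block (a b c d : nat) (P : 'M[C]_(a, c)) (Q : 'M[C]_(a, d))
    (T : 'M[C]_(b, c)) (U : 'M[C]_(b, d)) :
  ctrmx (block_mx P Q T U)
  = block_mx (ctrmx P) (ctrmx T) (ctrmx Q) (ctrmx U).
Proof. by rewrite /ctrmx tr_block_mx map_block_mx. Qed.

Lemma ctrmx_row (a c d : nat) (P : 'M[C]_(a, c)) (Q : 'M[C]_(a, d)) :
  ctrmx (row_mx P Q) = col_mx (ctrmx P) (ctrmx Q).
Proof. by rewrite /ctrmx tr_row_mx map_col_mx. Qed.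

Lemma ctrmx_col (a b c : nat) (P : 'M[C]_(a, c)) (Q : 'M[C]_(b, c)) :
  ctrmx (col_mx P Q) = row_mx (ctrmx P) (ctrmx Q).
Proof. by rewrite /ctrmx tr_col_mx map_row_mx. Qed.

Lemma posdef_block_diag (a b : nat) (P : 'M[C]_a) (Q : 'M[C]_b) :
  posdef (block_mx P 0 0 Q) -> posdef P /\ posdef Q.
Proof.
move=> [hH hpos].
move: (hH); rewrite /hermitian_mx ctrmx_block => /eq_block_mx[hP _ _ hQ].
split; split=> // v v0.
  have := hpos (col_mx v 0); rewrite ctrmx_col ctrmx0 mul_row_block mul_row_col.
  rewrite !mulmx0 ?mul0mx !addr0; apply.
  by apply: contra v0 => /eqP; rewrite -col_mx0 => /eq_col_mx[-> _].
have := hpos (col_mx 0 v); rewrite ctrmx_col ctrmx0 mul_row_block mul_row_col.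
rewrite !mulmx0 ?mul0mx !add0r; apply.
by apply: contra v0 => /eqP; rewrite -col_mx0 => /eq_col_mx[_ ->].
Qed.

Variables (p n : nat) (A : nat -> 'M[C]_p) (sm1 : 'M[C]_p) (s : nat -> 'M[C]_p).
Local Notation m := n./2.
Local Notation D := (\sum_(b < m) p)%N.
Local Notation B := (markov_row n s).
Local Notation H0 := (block_hankel s 0 m).
Local Notation H1 := (block_hankel s 1 m).

Hypothesis A0 : A 0%N = 1%:M.
Hypothesis markov : right_markov n A sm1 s.
Hypothesis sH : forall k : nat, (k < 2 * m)%N -> hermitian_mx (s k).
Hypothesis smH : odd n -> hermitian_mx sm1.
Hypothesis stab : hurwitz_stable n A.

Let H0H : ctrmx H0 = H0. Proof. exact: block_hankel_hermitian. Qed.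
Let H1H : ctrmx H1 = H1. Proof. exact: block_hankel_hermitian. Qed.

Lemma hurwitz_posdef_even : ~~ odd n -> posdef H0 /\ posdef H1.
Proof.
move=> ne.
pose K := block_mx H1 0 0 H0.
(* With [S = 0] the root equation is [y = B (z v)], so the pair [(v, z v)] already determines
   [y]. *)
pose M : 'M_(D + D) :=
  block_mx 0 1%:M (- companion n A) (- (first_block R p n *m B)).
pose L : 'M_(p, D + D) := row_mx 0 B.
suff /posdef_block_diag[] : posdef K by [].
have KH : ctrmx K = K by rewrite ctrmx_block H0H H1H !ctrmx0.
apply: (@lyapunov_posdef _ _ _ K M L) => //.
- have -> : ctrmx M *m K = ctrmx (K *m M) by rewrite ctrmxM KH.
  (* The corners [H1] and [- H1] cancel against the adjoint, which leaves twice [- B^* B]. *)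
  have -> : K *m M = block_mx 0 H1 (- H1) (- (ctrmx B *m B)).
    rewrite /K /M mulmx_block !mulmx0 !mul0mx !addr0 !add0r mulmx1 !mulmxN.
    by rewrite mulmxA (hankel_companion A0 markov) (hankel_first_block sH).
  rewrite ctrmx_block add_block_mx ctrmx0 !ctrmxN H1H ctrmxM ctrmxK.
  rewrite /L ctrmx_row mul_col_row ctrmx0 !mul0mx !mulmx0 scale_block_mx.
  by rewrite !scaler0 add0r addrN addNr scaleNr scaler_nat mulr2n opprD.
move=> z x x0 hx.
move: hx x0; rewrite -[x]vsubmxK; set x1 := usubmx x; set x2 := dsubmx x.
rewrite /M /L mul_block_col scale_col_mx mul_row_col !mul0mx !add0r mul1mx.
move=> /eq_col_mx[e1 e2] x0.
apply: (companion_stable A0 markov stab (x := x1)).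
- have -> : companion n A *m x1 + first_block R p n *m (B *m x2)
      = - (- companion n A *m x1 + - (first_block R p n *m B) *m x2).
    by rewrite !mulNmx opprD !opprK mulmxA.
  by rewrite e2 e1 scalerA -scaleNr.
- by rewrite (negPf ne) mul0mx scaler0 addr0 e1 scalemxAr.
- apply: contraNT x0; rewrite negb_or !negbK => /andP[/eqP x10 _].
  by rewrite e1 x10 scaler0 col_mx0.
Qed.

Lemma hurwitz_posdef_odd : odd n -> [/\ posdef H0, posdef H1 & posdef sm1].
Proof.
move=> no; set A1 := even_coef n A 0.
have sA : sm1 *m A1 = 1%:M by apply: (even_lead_unit A0 markov).2.
pose K := block_mx H1 0 0 (block_mx H0 0 0 sm1).
(* As [A1] is inverse to [sm1], the last block row encodes [z S y = B (z v) - y], the root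
   equation. *)
pose M : 'M_(D + (D + p)) := block_mx 0 (row_mx 1%:M 0)
  (col_mx (- companion n A) 0)
  (block_mx 0 (- first_block R p n) (A1 *m B) (- A1)).
pose L : 'M[C]_(p, D + (D + p)) := row_mx 0 (row_mx 0 1%:M).
suff /posdef_block_diag[h1 /posdef_block_diag[h0 h]] : posdef K by [].
have KH : ctrmx K = K.
  by rewrite !ctrmx_block H0H H1H (smH no) !ctrmx0.
apply: (@lyapunov_posdef _ _ _ K M L) => //.
- have -> : ctrmx M *m K = ctrmx (K *m M) by rewrite ctrmxM KH.
  (* All blocks off the diagonal form a skew-Hermitian matrix, so adding the adjoint leaves [-2]
     times the identity in the last block. *)
  have -> : K *m M = block_mx 0 (row_mx H1 0) (col_mx (- H1) 0)
      (block_mx 0 (- ctrmx B) B (- 1%:M)).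
    rewrite /K /M mulmx_block !mulmx0 !mul0mx !addr0 !add0r mul_mx_row.
    rewrite mul_block_col mulmx_block !mulmx0 !mul0mx !addr0 !add0r mulmx1.
    rewrite !mulmxN mulmxA sA mul1mx.
    by rewrite (hankel_companion A0 markov) (hankel_first_block sH).
  rewrite !ctrmx_block ctrmx_row ctrmx_col !ctrmx0 !ctrmxN H1H ctrmxK ctrmx1.
  rewrite !add_block_mx add_row_mx add_col_mx !addr0 addNr addrN addNr addrN.
  rewrite /L !ctrmx_row !mul_col_row.
  rewrite !ctrmx0 ctrmx1 !mul0mx !mulmx0 mulmx1.
  rewrite !row_mx0 !col_mx0 !scale_block_mx !scaler0.
  by rewrite scaleNr scaler_nat mulr2n opprD.
move=> z x x0 hx.
move: hx x0; rewrite -[x]vsubmxK -[dsubmx x]vsubmxK.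
set x1 := usubmx x; set x2 := usubmx (dsubmx x); set x3 := dsubmx (dsubmx x).
rewrite /M /L mul_block_col !mul_row_col mul_block_col mul_col_mx !scale_col_mx.
rewrite add_col_mx !mul0mx !add0r !addr0 !mul1mx.
move=> /eq_col_mx[e1 /eq_col_mx[e2 e3]] x0.
apply: (companion_stable A0 markov stab (x := x1)).
- have -> : companion n A *m x1 + first_block R p n *m x3
      = - (- companion n A *m x1 + - first_block R p n *m x3).
    by rewrite !mulNmx opprD !opprK.
  by rewrite e2 e1 scalerA -scaleNr.
- rewrite no; have := congr1 (mulmx sm1) e3.
  rewrite mulmxDr mulNmx mulmxN !mulmxA sA !mul1mx -scalemxAr => <-.
  by rewrite addrCA subrr addr0 e1 scalemxAr.
- apply: contraNT x0; rewrite negb_or !negbK => /andP[/eqP x10 /eqP ->].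
  by rewrite e1 x10 scaler0 !col_mx0.
Qed.

End LyapunovEquations.

Theorem theorem4p9 (R : realType) (p n : nat) (A : nat -> 'M[R[i]]_p)
    (sm1 : 'M[R[i]]_p) (s : nat -> 'M[R[i]]_p) :
  A 0%N = 1%:M ->
  (odd n -> regular (even_part n A)) ->
  right_markov n A sm1 s ->
  (forall k : nat, (k < 2 * n./2)%N -> hermitian_mx (s k)) ->
  (odd n -> hermitian_mx sm1) ->
  (hurwitz_stable n A <->
     [/\ posdef (block_hankel s 0 n./2),
         posdef (block_hankel s 1 n./2)
       & (odd n -> posdef sm1)]).
Proof.
move=> A0 _ markov sH smH; split=> [stab|[H0 H1 Sm]]; last first.
  exact: (posdef_hurwitz A0 markov sH smH H0 H1 Sm).
have [no|ne] := boolP (odd n).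
  by have [H0 H1 Sm] := hurwitz_posdef_odd A0 markov sH smH stab no.
by have [H0 H1] := hurwitz_posdef_even A0 markov sH stab ne.
Qed.
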